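(* Let $\mathcal X$ be a finite set, let $q_{t-1}, p_{\mathrm{pref}} \in \Delta(\mathcal X)$, and let $\delta>0$. Let $$\mathcal B_\delta(q_{t-1})=\{q\in\Delta(\mathcal X): D_{\mathrm{KL}}(q_{t-1}\|q)\le\delta\}$$ and let $q_t^\star$ be a minimizer of $q\mapsto D_{\mathrm{KL}}(q\|p_{\mathrm{pref}})$ over $q\in\mathcal B_\delta(q_{t-1})$. Then $$D_{\mathrm{KL}}(q_{t-1}\|p_{\mathrm{pref}})-D_{\mathrm{KL}}(q_t^\star\|p_{\mathrm{pref}})\ \ge\ D_{\mathrm{KL}}(q_{t-1}\|q_t^\star).$$
   Context: $\Delta(\mathcal X)=\{q\in\mathbb R_{\ge0}^{|\mathcal X|}:\sum_{x\in\mathcal X}q(x)=1\}$ is the probability simplex on the finite set $\mathcal X$. For $q,p\in\Delta(\mathcal X)$, $D_{\mathrm{KL}}(q\|p)=\sum_{x\in\mathcal X}q(x)\log\frac{q(x)}{p(x)}\in[0,\infty]$, with natural logarithm and the usual conventions $0\log(0/a)=0$ for $a\ge 0$ and $a\log(a/0)=+\infty$ for $a>0$. If infinite values occur, the inequality is read in the form $D_{\mathrm{KL}}(q_{t-1}\|p_{\mathrm{pref}})\ge D_{\mathrm{KL}}(q_{t-1}\|q_t^\star)+D_{\mathrm{KL}}(q_t^\star\|p_{\mathrm{pref}})$ in $[0,\infty]$. *)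

(* Defs.v *)
From HB Require Import structures.
From mathcomp Require Import all_boot all_order all_algebra.
From mathcomp Require Import all_classical all_reals all_analysis.

Set Implicit Arguments.
Unset Strict Implicit.
Unset Printing Implicit Defensive.

Import Order.TTheory GRing.Theory Num.Theory.

Local Open Scope classical_set_scope.
Local Open Scope ring_scope.

Definition simplex (R : realType) (X : finType) : set {ffun X -> R} :=
  [set q | (forall x, 0 <= q x) /\ \sum_(x : X) q x = 1].

(* Only meant for a, b >= 0; the case a = 0 takes precedence over b = 0. *)
Definition KL_term (R : realType) (a b : R) : \bar R :=
  if a == 0 then 0%E
  else if b == 0 then +oo%E
  else (a * ln (a / b))%:E.

(* No term is -oo, so the sum in \bar R never meets +oo - oo. *)
Definition KL (R : realType) (X : finType) (q p : {ffun X -> R}) : \bar R :=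
  (\sum_(x : X) KL_term (q x) (p x))%E.

(* The centre is the first argument of the divergence. *)
Definition KL_ball (R : realType) (X : finType) (q0 : {ffun X -> R})
    (delta : R) : set {ffun X -> R} :=
  [set q | simplex q /\ (KL q0 q <= delta%:E)%E].

Definition is_minimizer (R : realType) (T : Type) (f : T -> \bar R)
    (A : set T) (x : T) : Prop :=
  A x /\ forall y, A y -> (f x <= f y)%E.

(* Main.v *)
(** The minimizer [b] of [KL(. || p)] over a convex set satisfies Csiszár's
    Pythagorean inequality at every point [a] of the set: moving from [b] to
    [b + s (a - b)] changes [KL(. || p)] by
      [s * \sum_x (a x - b x) * ln (b x / p x)]
    up to an error at most [s^2] times a chi-square distance, and so minimality
    forces this sum, which is [KL(a || p) - KL(a || b) - KL(b || p)], to be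
    nonnegative.  The ball contains the segment between its centre and each of
    its points because [ln] is concave. *)
Require Import Defs.
From HB Require Import structures.
From mathcomp Require Import all_boot all_order all_algebra.
From mathcomp Require Import all_classical all_reals all_analysis.
From mathcomp Require Import ring lra.

Set Implicit Arguments.
Unset Strict Implicit.
Unset Printing Implicit Defensive.

Import Order.TTheory GRing.Theory Num.Theory.

Local Open Scope classical_set_scope.
Local Open Scope ring_scope.

Section KL_real.
Context {R : realType} {X : finType}.
Implicit Types a b p q : {ffun X -> R}.

(** Absolute continuity, which is equivalent to finiteness of [KL q p] on a finite set. *)
Definition dominated q p := forall x, p x = 0 -> q x = 0.

(* By the conventions [x / 0 = 0] and [ln 0 = 0], this is a junk value when [q]
   is not dominated by [p]. *)
Definition KLr q p : R := \sum_x q x * ln (q x / p x).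

Lemma KL_EFin q p : dominated q p -> KL q p = (KLr q p)%:E.
Proof.
move=> qp; rewrite /KL /KLr -sumEFin; apply: eq_bigr => x _; rewrite /KL_term.
have [-> | q0] := eqVneq (q x) 0; first by rewrite mul0r.
by have [/qp/eqP | //] := eqVneq (p x) 0; rewrite (negPf q0).
Qed.

(** As no summand is [-oo], one infinite summand makes the whole sum [+oo]. *)
Lemma KL_lty_dominated q p : (KL q p < +oo)%E -> dominated q p.
Proof.
move=> + x px0; apply: contraTeq => q0; rewrite ltey negbK /KL.
rewrite esum_eqy => [|y _]; last by rewrite /KL_term; do 2![case: ifP => // _].
by apply/existsP; exists x; rewrite /KL_term (negPf q0) px0 eqxx.
Qed.

Lemma ln_le_subr1 (x : R) : 0 < x -> ln x <= x - 1.
Proof.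
by move=> x0; rewrite -{1}(subrKC 1 x); apply: le_ln1Dx; lra.
Qed.

Definition segment b a (s : R) : {ffun X -> R} :=
  [ffun x => b x + s * (a x - b x)].

Lemma segment_simplex b a s : 0 <= s <= 1 ->
  simplex b -> simplex a -> simplex (segment b a s).
Proof.
move=> /andP[s0 s1] [b0 b1] [a0 a1]; split=> [x|].
  by rewrite ffunE; move: (a0 x) (b0 x) => ax bx; nra.
under eq_bigr do rewrite ffunE.
by rewrite big_split /= -mulr_sumr sumrB b1 a1 subrr mulr0 addr0.
Qed.

Lemma segment_gt0 b a s x : 0 <= s < 1 -> 0 <= a x -> 0 < b x ->
  0 < segment b a s x.
Proof. by move=> /andP[s0 s1] a0 b0; rewrite ffunE; nra. Qed.

Lemma segment_dominated b a p s :
  dominated b p -> dominated a b -> dominated (segment b a s) p.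
Proof.
by move=> bp ab x /bp b0; rewrite ffunE b0 (ab _ b0) subrr mulr0 addr0.
Qed.

Lemma KLr_segment_center b a s : 0 <= s < 1 ->
  (forall x, 0 <= a x) -> (forall x, 0 <= b x) -> dominated a b ->
  KLr a (segment b a s) <= (1 - s) * KLr a b.
Proof.
move=> s01 a0 b0 ab; rewrite /KLr mulr_sumr; apply: ler_sum => x _.
have [-> | ax0] := eqVneq (a x) 0; first by rewrite !mul0r mulr0.
have bx0 : b x != 0 by apply: contra_neq ax0 => /ab.
have {ax0}ax : 0 < a x by rewrite lt_def ax0 a0.
have {bx0}bx : 0 < b x by rewrite lt_def bx0 b0.
have mx := segment_gt0 s01 (a0 x) bx.
set m := segment b a s x in mx *.
rewrite mulrCA ler_pM2l// !ln_div ?posrE//.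
have := ln_le_subr1 (divr_gt0 ax mx); have := ln_le_subr1 (divr_gt0 bx mx).
rewrite !ln_div ?posrE// => lb la.
case/andP: s01 => s0 s1.
(* As [m] is a convex combination of [a x] and [b x], the tangent bounds [la] and [lb] at [m] cancel
   when weighted by [s] and [1 - s]. What remains is [s * ln (a x) + (1 - s) * ln (b x) <= ln m]. *)
have tangent : s * (a x / m - 1) + (1 - s) * (b x / m - 1) = 0.
  have -> : s * (a x / m - 1) + (1 - s) * (b x / m - 1) =
    (b x + s * (a x - b x)) / m - 1 by ring.
  by rewrite /m ffunE divff ?subrr//; move: mx; rewrite /m ffunE => /lt0r_neq0.
nra.
Qed.

Lemma KLr_pythagorean_defect a b p :
  (forall x, 0 <= a x) -> (forall x, 0 <= b x) -> (forall x, 0 <= p x) ->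
  dominated a b -> dominated b p ->
  KLr a p = KLr a b + KLr b p + \sum_x (a x - b x) * ln (b x / p x).
Proof.
move=> a0 b0 p0 ab bp; rewrite /KLr -!big_split; apply: eq_bigr => x _ /=.
have [bx0 | bx0] := eqVneq (b x) 0.
  by rewrite (ab _ bx0) bx0 subrr !mul0r !addr0.
have [ax0 | ax0] := eqVneq (a x) 0; first by rewrite ax0; ring.
have px0 : p x != 0 by apply: contra_neq bx0 => /bp.
have {ax0}ax : 0 < a x by rewrite lt_def ax0 a0.
have {bx0}bx : 0 < b x by rewrite lt_def bx0 b0.
have {px0}px : 0 < p x by rewrite lt_def px0 p0.
by rewrite !ln_div ?posrE//; ring.
Qed.

Lemma KLr_segment_le b a p s : 0 <= s < 1 ->
  (forall x, 0 <= p x) -> simplex b -> simplex a ->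
  dominated a b -> dominated b p ->
  KLr (segment b a s) p <=
    KLr b p + s * (\sum_x (a x - b x) * ln (b x / p x)) +
    s ^+ 2 * (\sum_x (a x - b x) ^+ 2 / b x).
Proof.
move=> s01 p0 [b0 b1] [a0 a1] ab bp.
(* The first-order terms [s * (a x - b x)], which sum to zero, make the bound
   hold summand by summand. *)
have -> : KLr b p = KLr b p + s * \sum_x (a x - b x).
  by rewrite sumrB a1 b1 subrr mulr0 addr0.
rewrite /KLr !mulr_sumr -!big_split; apply: ler_sum => x _ /=.
have [bx0 | bx0] := eqVneq (b x) 0.
  by rewrite ffunE bx0 (ab _ bx0) subrr expr0n !(mulr0, mul0r, addr0).
have px0 : p x != 0 by apply: contra_neq bx0 => /bp.
have {px0}px : 0 < p x by rewrite lt_def px0 p0.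
have {bx0}bx : 0 < b x by rewrite lt_def bx0 b0.
have mx := segment_gt0 s01 (a0 x) bx.
set m := segment b a s x in mx *.
have := ler_wpM2l (ltW mx) (ln_le_subr1 (divr_gt0 mx bx)).
rewrite !ln_div ?posrE//.
have chi2 : m * (m / b x - 1) =
    s * (a x - b x) + s ^+ 2 * ((a x - b x) ^+ 2 / b x).
  by rewrite /m ffunE; field; rewrite gt_eqF.
rewrite chi2 => le_m.
(* Only the first part needs the estimate [le_m]; the second is affine in [s], since [m] is. *)
have -> : m * (ln m - ln (p x)) =
  m * (ln m - ln (b x)) + m * (ln (b x) - ln (p x)) by ring.
apply: le_trans (lerD le_m (lexx _)) _.
by rewrite {1}/m ffunE le_eqVlt; apply/orP; left; apply/eqP; ring.
Qed.

Lemma ge0_first_order (D K : R) : 0 <= K ->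
  (forall s, 0 < s < 1 -> 0 <= s * D + s ^+ 2 * K) -> 0 <= D.
Proof.
move=> K0 DK; rewrite leNgt; apply/negP => D0.
have den : 0 < K + 1 - D by lra.
(* A step small enough for the linear term to win: with this [s], [D + s * K = - s * (1 - D)], which
   is negative when [D < 0]. *)
pose s := - D / (K + 1 - D).
have s0 : 0 < s by rewrite divr_gt0// oppr_gt0.
have s1 : s < 1 by rewrite ltr_pdivrMr//; lra.
have /DK : 0 < s < 1 by rewrite s0 s1.
rewrite expr2 -mulrA -mulrDr pmulr_rge0//.
have sden : s * (K + 1 - D) = - D by rewrite divfK// gt_eqF.
nra.
Qed.

Lemma KLr_pythagoras a b p :
  (forall x, 0 <= p x) -> simplex b -> simplex a ->
  dominated a b -> dominated b p ->
  (forall s, 0 < s < 1 -> KLr b p <= KLr (segment b a s) p) ->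
  KLr a b + KLr b p <= KLr a p.
Proof.
move=> p0 sb sa ab bp bmin; have [[b0 _] [a0 _]] := (sb, sa).
rewrite (KLr_pythagorean_defect a0 b0 p0 ab bp) lerDl.
apply: (@ge0_first_order _ (\sum_x (a x - b x) ^+ 2 / b x)).
  by apply: sumr_ge0 => x _; rewrite divr_ge0// sqr_ge0.
move=> s s01; have /andP[s0 s1] := s01.
have s01' : 0 <= s < 1 by rewrite ltW.
have := le_trans (bmin s s01) (KLr_segment_le s01' p0 sb sa ab bp).
by rewrite -addrA lerDl.
Qed.

Lemma segment_KL_ball a b delta s : 0 <= s < 1 -> 0 <= delta -> simplex a ->
  KL_ball a delta b -> KL_ball a delta (segment b a s).
Proof.
move=> s01 d0 sa [sb ab_delta]; have [[b0 _] [a0 _]] := (sb, sa).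
have ab := KL_lty_dominated (le_lt_trans ab_delta (ltry _)).
case/andP: (s01) => s0 s1; split.
  by apply: segment_simplex => //; rewrite s0 ltW.
rewrite KL_EFin => [|x]; last first.
  (* For [s < 1] the segment vanishes only where [b] does, and there [a] vanishes too. *)
  have [bx0 _|bx0 mx0] := eqVneq (b x) 0; first exact: ab.
  have bx : 0 < b x by rewrite lt_def bx0 b0.
  by have := segment_gt0 s01 (a0 x) bx; rewrite mx0 ltxx.
move: ab_delta; rewrite KL_EFin// !lee_fin => ab_delta.
by apply: le_trans (KLr_segment_center s01 a0 b0 ab) _; nra.
Qed.

End KL_real.

Theorem theorem1 (R : realType) (X : finType)
    (qprev ppref qstar : {ffun X -> R}) (delta : R)
    (hqprev : simplex qprev) (hppref : simplex ppref) (hdelta : 0 < delta)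
    (hqstar : is_minimizer (fun q => KL q ppref) (KL_ball qprev delta) qstar) :
  (KL qprev ppref \is a fin_num -> KL qstar ppref \is a fin_num ->
   KL qprev qstar \is a fin_num ->
   (KL qprev ppref - KL qstar ppref >= KL qprev qstar)%E) /\
  (KL qprev ppref >= KL qprev qstar + KL qstar ppref)%E.
Proof.
have [bball bmin] := hqstar; have [sb ab_delta] := bball; have [p0 _] := hppref.
have ab := KL_lty_dominated (le_lt_trans ab_delta (ltry _)).
suff pyth : (KL qprev qstar + KL qstar ppref <= KL qprev ppref)%E.
  by split=> // _ bp_fin _; rewrite leeBrDr.
have [-> | apNy] := eqVneq (KL qprev ppref) +oo%E; first exact: leey.
have ap_lty : (KL qprev ppref < +oo)%E by rewrite ltey.
(* The centre competes in the minimization, so the minimum is at most [KL qprev ppref], hence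
   finite; this gives domination of [qstar] by [ppref]. *)
have aball : KL_ball qprev delta qprev.
  split=> //; rewrite KL_EFin// lee_fin (le_trans _ (ltW hdelta))// sumr_le0//.
  move=> x _; have [-> | a0] := eqVneq (qprev x) 0; first by rewrite mul0r.
  by rewrite divff// ln1 mulr0.
have bp := KL_lty_dominated (le_lt_trans (bmin _ aball) ap_lty).
have ap := KL_lty_dominated ap_lty.
rewrite !KL_EFin// -EFinD lee_fin; apply: KLr_pythagoras => // s /andP[s0 s1].
rewrite -lee_fin -!KL_EFin//; last exact: segment_dominated.
by apply/bmin/segment_KL_ball => //; rewrite ?ltW ?s1.
Qed.
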